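(* A map $\Psi:\mathrm{Conv}(\mathbb{R}^n)\to\mathrm{Conv}(\mathbb{R}^n)$ is continuous, additive, monotone, as well as radially and $\mathrm{SO}(n)$-equivariant if and only if $\Psi\equiv0$, or $\Psi\equiv\mathbf{1}_{\{0\}}^\infty$, or there exist $\lambda>0$ and $\mu\in\mathbb{R}\setminus\{0\}$ such that $$\Psi(f)[x]=\lambda f(\mu x),\qquad x\in\mathbb{R}^n,$$ for every $f\in\mathrm{Conv}(\mathbb{R}^n)$.
   Context: $\mathrm{Conv}(\mathbb{R}^n)$ is the set of all lower semi-continuous convex functions $f:\mathbb{R}^n\to(-\infty,+\infty]$ that are not identically $+\infty$. It carries the topology induced by epi-convergence: $f_j$ epi-converges to $f$ if for every $x\in\mathbb{R}^n$ (i) $f(x)\le\liminf_j f_j(x_j)$ for every sequence $x_j\to x$, and (ii) there is a sequence $x_j\to x$ with $f(x)=\lim_j f_j(x_j)$. Continuity of $\Psi$ refers to this topology. $\Psi(f)[x]$ denotes the value of $\Psi(f)$ at $x$. $\Psi$ is additive if $\Psi(g+h)=\Psi(g)+\Psi(h)$ for all $g,h\in\mathrm{Conv}(\mathbb{R}^n)$ with $g+h\in\mathrm{Conv}(\mathbb{R}^n)$ (in particular $\Psi(g)+\Psi(h)\in\mathrm{Conv}(\mathbb{R}^n)$ is required in that case); monotone if $f\le g$ pointwise implies $\Psi(f)\le\Psi(g)$ pointwise; radially equivariant if $\Psi(f)[tx]=\Psi(f(t\,\cdot))[x]$ for all $t>0$, $x\in\mathbb{R}^n$ and all $f$; $\mathrm{SO}(n)$-equivariant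 if $\Psi(\eta\cdot f)=\eta\cdot\Psi(f)$ for all $\eta\in\mathrm{SO}(n)$ and all $f$, where $(\eta\cdot f)(x)=f(\eta^{-1}x)$. $\mathbf{1}_{\{0\}}^\infty$ is the function equal to $0$ at $0$ and $+\infty$ elsewhere. $\Psi\equiv g$ means that $\Psi(f)=g$ for all $f$.
   Formalization: The formal theorem assumes n ≥ 3; as stated the equivalence fails for n = 1 (Ψ constantly the 0/+∞ indicator of [0,∞)) and n = 2 (Ψ(f)[x] = f(ρx), ρ a rotation other than ±id). *)

(* Defs.v *)
From HB Require Import structures.
From mathcomp Require Import all_boot all_order all_algebra.
From mathcomp Require Import all_classical all_reals all_analysis.

Set Implicit Arguments.
Unset Strict Implicit.
Unset Printing Implicit Defensive.

Import Order.TTheory GRing.Theory Num.Theory.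
Import numFieldNormedType.Exports.

Local Open Scope classical_set_scope.
Local Open Scope ring_scope.

(* R^n is 'cV[R]_n, so that matrices act on the left. *)

Definition ereal_convex (R : realType) (n : nat) (f : 'cV[R]_n -> \bar R) :=
  forall (x y : 'cV[R]_n) (t : R), 0 < t < 1 ->
    (f (t *: x + (1 - t) *: y)%R <= t%:E * f x + (1 - t)%:E * f y)%E.

(* Since +oo + -oo = -oo in \bar R, ereal_convex is only meaningful together
   with the requirement that f does not take the value -oo. *)
Record is_conv (R : realType) (n : nat) (f : 'cV[R]_n -> \bar R) : Prop :=
  IsConv {
    conv_gtNy : forall x, (-oo < f x)%E ;
    conv_proper : exists x, f x <> +oo%E ;
    conv_convex : ereal_convex f ;
    conv_lsc : lower_semicontinuous f }.

Record Conv (R : realType) (n : nat) := MkConv {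
  conv_fun :> 'cV[R]_n -> \bar R ;
  convP : is_conv conv_fun }.

HB.instance Definition _ (R : realType) (n : nat) := gen_eqMixin (Conv R n).
HB.instance Definition _ (R : realType) (n : nat) :=
  gen_choiceMixin (Conv R n).

Definition epi_cvg (R : realType) (n : nat) (f_ : nat -> Conv R n)
    (f : Conv R n) : Prop :=
  forall x : 'cV[R]_n,
    (forall x_ : nat -> 'cV[R]_n, x_ @ \oo --> x ->
       (f x <= limn_einf (fun j => f_ j (x_ j)))%E) /\
    (exists x_ : nat -> 'cV[R]_n, x_ @ \oo --> x /\
       (fun j => f_ j (x_ j)) @ \oo --> f x).

(* The topology induced by epi-convergence: U is open when every sequence that
   epi-converges to a point of U is eventually in U. *)
Definition epi_open (R : realType) (n : nat) (U : set (Conv R n)) : Prop :=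
  forall (f_ : nat -> Conv R n) (f : Conv R n),
    epi_cvg f_ f -> U f -> \forall j \near \oo, U (f_ j).

Section epi_topology.
Context {R : realType} {n : nat}.

Let epi_openT : epi_open (@setT (Conv R n)).
Proof. by move=> f_ f _ _; exact: nearW. Qed.

Let epi_openI : setI_closed (@epi_open R n).
Proof.
move=> A B oA oB f_ f ff [Af Bf].
by apply: filterI; [exact: (oA _ f)|exact: (oB _ f)].
Qed.

Let epi_open_bigU (I : Type) (F : I -> set (Conv R n)) :
  (forall i, epi_open (F i)) -> epi_open (\bigcup_i F i).
Proof.
move=> oF f_ f ff [i _ Fif].
by apply: filterS (oF i _ _ ff Fif) => j Fij; exists i.
Qed.

HB.instance Definition _ := isOpenTopological.Build (Conv R n)
  epi_openT epi_openI epi_open_bigU.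
End epi_topology.

Lemma is_conv_comp (R : realType) (n : nat) (L M : 'cV[R]_n -> 'cV[R]_n)
    (f : Conv R n) : linear L -> continuous L -> cancel M L ->
  is_conv (fun x => f (L x)).
Proof.
move=> lL cL ML; case: f => f [fNy [p fp] fc fl] /=.
have L0 : L 0 = 0.
  by have := lL (-1) 0 0; rewrite scaler0 addr0 scaleN1r addNr.
split => [x||x y t t01|x a afx]; first exact: fNy.
- by exists (M p); rewrite ML.
- have -> : L (t *: x + (1 - t) *: y) = t *: L x + (1 - t) *: L y.
    by rewrite lL -[(1 - t) *: y]addr0 lL L0 addr0.
  exact: fc.
- have [V Vx Va] := fl _ _ afx.
  by exists (L @^-1` V); [exact: cL|move=> y /Va].
Qed.

Lemma is_conv_dilate (R : realType) (n : nat) (t : R) (f : Conv R n) :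
  0 < t -> is_conv (fun x => f (t *: x)).
Proof.
move=> t0; apply: (is_conv_comp (M := fun x => t^-1 *: x)).
- by move=> a x y; rewrite scalerDr !scalerA mulrC.
- exact: scaler_continuous.
- by move=> x; rewrite scalerA divff ?gt_eqF// scale1r.
Qed.

Definition dilate (R : realType) (n : nat) (t : R) (t0 : 0 < t)
    (f : Conv R n) : Conv R n := MkConv (is_conv_dilate f t0).

Definition is_SO (R : realType) (n : nat) (eta : 'M[R]_n) : Prop :=
  eta^T *m eta = 1%:M /\ \det eta = 1.

Lemma mulmx_col_continuous (R : realType) (n : nat) (A : 'M[R]_n) :
  continuous (fun x : 'cV[R]_n => A *m x).
Proof.
move=> x U [P Px PU].
have H i j : \forall y \near x, P i j ((A *m y) i j).
  have : (\sum_k A i k * y k j) @[y --> x] --> \sum_k A i k * x k j.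
    apply: (@cvg_big _ _ +%R 0 _ _ _ (nbhs x)) => [|k _].
      exact: add_continuous.
    by apply: cvgM; [exact: cvg_cst|exact: coord_continuous].
  move=> /(_ (P i j)) h; have := Px i j; rewrite mxE => /h.
  by apply: (@filterS _ (nbhs x)) => y; rewrite /= mxE.
have HH : \forall y \near x, forall i j, P i j ((A *m y) i j).
  apply: (@filter_forall _ _ _ (nbhs x)) => i.
  exact: (@filter_forall _ _ _ (nbhs x)) (H i).
by apply: (@filterS _ (nbhs x)) HH => y Hy; apply: PU.
Qed.

Lemma is_conv_rotate (R : realType) (n : nat) (eta : 'M[R]_n) (f : Conv R n) :
  is_SO eta -> is_conv (fun x => f (invmx eta *m x)).
Proof.
move=> [_ deta]; apply: (is_conv_comp (M := fun x => eta *m x)).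
- by move=> a x y; rewrite mulmxDr scalemxAr.
- exact: mulmx_col_continuous.
- by move=> x; rewrite mulmxA mulVmx ?mul1mx// unitmxE deta unitr1.
Qed.

Definition rotate (R : realType) (n : nat) (eta : 'M[R]_n) (etaP : is_SO eta)
    (f : Conv R n) : Conv R n := MkConv (is_conv_rotate f etaP).

Definition additive_map (R : realType) (n : nat) (Psi : Conv R n -> Conv R n) :=
  forall (g h : Conv R n) (gh : is_conv (fun x => g x + h x)%E) (x : 'cV[R]_n),
    Psi (MkConv gh) x = (Psi g x + Psi h x)%E.

Definition monotone_map (R : realType) (n : nat) (Psi : Conv R n -> Conv R n) :=
  forall f g : Conv R n, (forall x, (f x <= g x)%E) ->
    forall x, (Psi f x <= Psi g x)%E.

Definition radially_equivariant (R : realType) (n : nat)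
    (Psi : Conv R n -> Conv R n) :=
  forall (t : R) (t0 : 0 < t) (f : Conv R n) (x : 'cV[R]_n),
    Psi f (t *: x) = Psi (dilate t0 f) x.

Definition SO_equivariant (R : realType) (n : nat)
    (Psi : Conv R n -> Conv R n) :=
  forall (eta : 'M[R]_n) (etaP : is_SO eta) (f : Conv R n),
    Psi (rotate etaP f) = rotate etaP (Psi f).

Definition ind0 (R : realType) (n : nat) (x : 'cV[R]_n) : \bar R :=
  if x == 0 then 0%E else +oo%E.

(* Main.v *)
Require Import Defs.
From HB Require Import structures.
From mathcomp Require Import all_boot all_order all_algebra.
From mathcomp Require Import all_classical all_reals all_analysis.
From mathcomp Require Import fingroup perm zify ring lra.

(** Write 1_C for the function that is 0 on C and +oo elsewhere.

    The argument rests on evaluating Psi through the functions 1_p, p a point.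
    If f is finite at p, then f + 1_p = f(p) + 1_p, the constant f(p) on the
    right; by additivity, Psi f agrees with Psi of that constant wherever
    Psi 1_p is finite ([additive_eq_cst]).  As 1_p + 1_p = 1_p, the function
    Psi 1_p takes no values but 0 and +oo, and being proper it vanishes
    somewhere.  So Psi is known on finite values once Psi is known on constants
    and the zero sets of the Psi 1_p are located.

    The zero function is idempotent too, and the zero set K of Psi 0 is a
    convex cone stable under SO(n).  Averaging over sign changes of two
    coordinates and moving coordinates by 3-cycles shows, for n >= 3, that K
    is {0} or R^n ([additive_zero_cases]).

    If K = {0}, then Psi f = Psi f + Psi 0 is +oo away from 0, hence every
    Psi 1_p vanishes at 0 and Psi f at 0 depends only on a single finite value
    of f, whichever one is taken.  A coordinate function takes all real values,
    so all constants have the same image as 0, and Psi f = 1_0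
    ([endomorphism_ind0]).

    If K = R^n, then functions u such that u and -u are both convex have affine
    images.  Monotonicity and radial equivariance give Psi c = l c for the
    constants, with l >= 0 ([image_cst]); the symmetries give
    Psi (x_i) = m x_i with m independent of i ([image_coordinate]).

    - Suppose l = 0.  On a ball B_j of radius j the cone k|z - p| lies between
      two constants, so its image is at most Psi 1_(B_j), which converges to
      Psi 0 = 0 as j grows.  So the cones are sent to 0, and since they converge
      to 1_p as k grows, Psi 1_p = 0 for every p; therefore Psi = 0
      ([endomorphism_zero]).  This is where continuity enters: the map sending
      f to its recession function, x |-> lim f(p + t x) / t for p in the domain
      of f and t going to infinity, has all the other properties.

    - Suppose l > 0.  Comparing coordinates on the zero set of Psi 1_p gives
      m x = l p there, so m <> 0 and that set is the single point (l/m) p.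
      Thus Psi f x = l f((m/l) x) when the right-hand side is finite.  When
      f is +oo at p = (m/l) x, restricting f to a segment from p to a point of
      its domain and comparing with affine functions that are arbitrarily large
      at p shows that Psi f x = +oo ([endomorphism_dilation]). *)

Set Implicit Arguments.
Unset Strict Implicit.
Unset Printing Implicit Defensive.

Import Order.TTheory GRing.Theory Num.Theory.
Import numFieldNormedType.Exports.

Local Open Scope classical_set_scope.
Local Open Scope ring_scope.

(** * Extended reals and inferior limits *)

Section extended_reals.
Context {R : realType}.
Implicit Types u : nat -> \bar R.

Lemma lte_between (x y : \bar R) :
  (x < y)%E -> exists r : R, (x < r%:E)%E /\ (r%:E < y)%E.
Proof.
case: x y => [x| |] [y| |] //=.
- rewrite lte_fin => xy; exists ((x + y) / 2).
  by rewrite !lte_fin !midf_lt.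
- by move=> _; exists (x + 1); rewrite lte_fin ltry; split => //; lra.
- by move=> _; exists (y - 1); rewrite lte_fin ltNyr; split => //; lra.
- by move=> _; exists 0; rewrite ltry ltNyr.
Qed.

Lemma limn_einfE u : limn_einf u = ereal_sup (range (einfs u)).
Proof.
rewrite limn_einf_lim; apply/cvg_lim => //.
exact/ereal_nondecreasing_cvgn/nondecreasing_einfs.
Qed.

Lemma near_gt_limn_einf u (a : \bar R) :
  (a < limn_einf u)%E -> \forall j \near \oo, (a < u j)%E.
Proof.
rewrite limn_einfE => /ereal_sup_gt[_ [N _ <-] aN].
exists N => // j /= Nj; apply: (lt_le_trans aN).
by apply: ereal_inf_lbound; exists j.
Qed.

Lemma limn_einf_ge u (l : \bar R) :
  (forall a : R, (a%:E < l)%E -> \forall j \near \oo, (a%:E <= u j)%E) ->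
  (l <= limn_einf u)%E.
Proof.
move=> h; rewrite leNgt; apply/negP => /lte_between[a [ua /h[N _ aN]]].
move: ua; apply/negP; rewrite -leNgt limn_einfE.
apply: (@le_trans _ _ (einfs u N)); last by apply: ereal_sup_ubound; exists N.
by apply: le_ereal_inf_tmp => _ [j /= Nj <-]; exact: aN.
Qed.

End extended_reals.

(** * Building elements of Conv *)

Section conv_constructions.
Context {R : realType} {n : nat}.
Implicit Types (f g : Conv R n) (x y p q : 'cV[R]_n) (S : set 'cV[R]_n).

Lemma conv_ext f g : f =1 g -> f = g.
Proof.
case: f g => f fP [g gP] /= fg; have {}fg : f = g by apply/funext.
by subst g; congr MkConv; exact: Prop_irrelevance.
Qed.

Lemma is_conv_real (h : 'cV[R]_n -> R) : continuous h ->
  (forall x y t, 0 < t < 1 ->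
    h (t *: x + (1 - t) *: y) <= t * h x + (1 - t) * h y) ->
  is_conv (fun x => (h x)%:E).
Proof.
move=> ch hc; split.
- by move=> x; rewrite ltNyr.
- by exists 0.
- by move=> x y t t01; rewrite -!EFinM -EFinD lee_fin; exact: hc.
- move=> x a; rewrite lte_fin => ahx; exists [set y | a < h y] => //.
  exact: (ch x _ (lt_nbhsr ahx)).
Qed.

Lemma is_conv_cst (c : R) : is_conv (fun=> c%:E : \bar R) (n := n).
Proof.
apply: (@is_conv_real (fun=> c)) => [x|x y t _]; first exact: cst_continuous.
by rewrite /=; lra.
Qed.

Definition cst_conv (c : R) : Conv R n := MkConv (is_conv_cst c).

Lemma is_conv_affine (i : 'I_n) (c d : R) :
  is_conv (fun x : 'cV[R]_n => (c * x i 0 + d)%:E).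
Proof.
apply: (@is_conv_real (fun x => c * x i 0 + d)) => [x|x y t _]; last first.
  by rewrite !mxE; lra.
apply: (@cvgD _ _ _ (nbhs x)); last exact: cvg_cst.
by apply: (@cvgM _ _ (nbhs x)); [exact: cvg_cst|exact: coord_continuous].
Qed.

Definition affine_conv i c d : Conv R n := MkConv (is_conv_affine i c d).

Lemma is_conv_cone (k : nat) p :
  is_conv (fun x : 'cV[R]_n => (k%:R * `|x - p|)%:E).
Proof.
apply: (@is_conv_real (fun x => k%:R * `|x - p|)) => [x|x y t /andP[t0 t1]].
  apply: (@cvgM _ _ (nbhs x)); first exact: cvg_cst.
  apply: (@cvg_norm _ _ _ (nbhs x)).
  by apply: (@cvgB _ _ _ (nbhs x)); [exact: cvg_id|exact: cvg_cst].
have -> : t *: x + (1 - t) *: y - p = t *: (x - p) + (1 - t) *: (y - p).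
  by apply/matrixP => i j; rewrite !mxE; lra.
rewrite (le_trans (ler_wpM2l _ (ler_normD _ _)))//.
by rewrite !normrZ !gtr0_norm//; lra.
Qed.

Definition cone_conv k p : Conv R n := MkConv (is_conv_cone k p).

(** [restr f S] is f + 1_S.  The sums below that involve an arbitrary f all have
    this form, so a single proof that such a sum is in Conv serves for them. *)
Definition restr (f : 'cV[R]_n -> \bar R) S x : \bar R :=
  if `[< S x >] then f x else +oo%E.

Lemma restr_in (f : 'cV[R]_n -> \bar R) S x : S x -> restr f S x = f x.
Proof. by move=> Sx; rewrite /restr asboolT. Qed.

Lemma restr_out (f : 'cV[R]_n -> \bar R) S x : ~ S x -> restr f S x = +oo%E.
Proof. by move=> Sx; rewrite /restr asboolF. Qed.

Definition convex_closed S := closed S /\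
  forall x y t, 0 < t < 1 -> S x -> S y -> S (t *: x + (1 - t) *: y).

Lemma is_conv_restr f S : convex_closed S ->
  (exists2 x, S x & f x <> +oo%E) -> is_conv (restr f S).
Proof.
move=> [cS vS] [x0 Sx0 fx0]; split.
- move=> x; rewrite /restr; case: asboolP => // _.
  exact: (conv_gtNy (convP f)).
- by exists x0; rewrite restr_in.
- move=> x y t t01; have /andP[t0 t1] := t01.
  have gtNy z : (-oo < restr f S z)%E.
    by rewrite /restr; case: asboolP => // _; exact: (conv_gtNy (convP f)).
  have gtNye (a : R) z : 0 < a -> (a%:E * restr f S z != -oo)%E.
    move=> a0; have := gtNy z; case: (restr f S z) => [r| |] //= _.
    by rewrite gt0_muley ?lte_fin.
  have t1' : 0 < 1 - t by lra.
  have [Sx|Sx] := pselect (S x); last first.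
    rewrite (restr_out _ Sx) gt0_muley ?lte_fin// addye ?leey//.
    exact: gtNye.
  have [Sy|Sy] := pselect (S y); last first.
    rewrite (restr_out _ Sy) (gt0_muley (x := (1 - t)%:E)) ?lte_fin//.
    by rewrite addey ?leey//; exact: gtNye.
  rewrite !restr_in//; last exact: vS.
  exact: (conv_convex (convP f)).
- move=> x a; have [Sx|Sx] := pselect (S x).
    rewrite restr_in// => /(conv_lsc (convP f))[V Vx Va].
    exists V => // y /Va ay; rewrite /restr; case: asboolP => // _.
    exact: ltry.
  move=> _; exists (~` S).
    by apply: open_nbhs_nbhs; split => //; exact: closed_openC.
  by move=> y Sy; rewrite restr_out// ltry.
Qed.

Lemma convex_closed1 p : convex_closed [set p].
Proof.
split.
  by apply: compact_closed; [exact: norm_hausdorff|exact: compact_set1].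
by move=> x y t _ /= -> ->; rewrite -scalerDl addrC subrK scale1r.
Qed.

Definition closed_nball (j : nat) : set 'cV[R]_n := [set x | `|x| <= j%:R].

Lemma convex_closed_nball j : convex_closed (closed_nball j).
Proof.
split.
  have -> : closed_nball j = Num.norm @^-1` [set t : R | t <= j%:R] by [].
  by apply: closed_comp => [x _|]; [exact: norm_continuous|exact: closed_le].
move=> x y t /andP[t0 t1] xj yj; rewrite /closed_nball /=.
rewrite (le_trans (ler_normD _ _))// !normrZ !gtr0_norm; [|lra..].
have : t * `|x| <= t * j%:R by apply: ler_wpM2l xj; lra.
have : (1 - t) * `|y| <= (1 - t) * j%:R by apply: ler_wpM2l yj; lra.
by lra.
Qed.

Definition segment q p : set 'cV[R]_n :=
  [set q + s *: (p - q) | s in `[0, 1]].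

Lemma line_continuous q p : continuous (fun s : R => q + s *: (p - q)).
Proof.
move=> s; apply: cvgD; first exact: cvg_cst.
exact: scalel_continuous.
Qed.

Lemma convex_closed_segment q p : convex_closed (segment q p).
Proof.
split.
  apply: compact_closed; first exact: norm_hausdorff.
  apply: continuous_compact; last exact: segment_compact.
  by apply: continuous_subspaceT; exact: line_continuous.
move=> x y t /andP[t0 t1] [s + <-] [r + <-].
rewrite /= !in_itv /= => /andP[s0 s1] /andP[r0 r1].
exists (t * s + (1 - t) * r).
  by rewrite /= in_itv /=; apply/andP; split; nra.
by apply/matrixP => i j; rewrite !mxE/=; ring.
Qed.

Lemma proper_pt f : exists p (r : R), f p = r%:E.
Proof.
have [p] := conv_proper (convP f); have := conv_gtNy (convP f) p.
by case fp : (f p) => [r| |] // _ _; exists p, r.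
Qed.
End conv_constructions.

(** * The epi-topology: open sets and convergent sequences *)

Section epi_topology.
Context {R : realType} {n : nat}.
Implicit Types (f g : Conv R n) (x y p q : 'cV[R]_n).

(** If g is below h at some point and g_j epi-converges to g, a sequence of
    points recovering the value of g stays below h, by semicontinuity of h. With
    [open_conv_gt] this replaces any separation property of the topology. *)
Lemma open_not_ge (h : 'cV[R]_n -> \bar R) : lower_semicontinuous h ->
  open [set g : Conv R n | exists x, (g x < h x)%E].
Proof.
move=> lh; change (epi_open [set g : Conv R n | exists x, (g x < h x)%E]).
move=> f_ f ff [x /lte_between[a [fa ah]]].
have [_ [x_ [xx fx]]] := ff x; have [V Vx Va] := lh x a ah.
have h1 : \forall j \near \oo, V (x_ j) by exact: (xx _ Vx).
have h2 : \forall j \near \oo, (f_ j (x_ j) < a%:E)%E.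
  apply: (fx [set z | (z < a%:E)%E]).
  by apply: open_nbhs_nbhs; split => //; exact: open_ereal_lt_ereal.
apply: filterS2 h1 h2 => j /Va h1 h2.
by exists (x_ j); exact: lt_trans h2 h1.
Qed.

(** The liminf condition along a constant sequence. *)
Lemma open_conv_gt (x : 'cV[R]_n) (a : \bar R) :
  open [set g : Conv R n | (a < g x)%E].
Proof.
change (epi_open [set g : Conv R n | (a < g x)%E]).
move=> f_ f ff ax; have [lf _] := ff x.
apply: near_gt_limn_einf; apply: (lt_le_trans ax).
by apply: lf; exact: cvg_cst.
Qed.

Lemma continuous_epi_cvg (Psi : Conv R n -> Conv R n)
    (f_ : nat -> Conv R n) f (U : set (Conv R n)) :
  continuous Psi -> epi_cvg f_ f -> open U -> U (Psi f) ->
  \forall j \near \oo, U (Psi (f_ j)).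
Proof.
move=> /continuousP cPsi ff /cPsi oU Uf.
exact: (oU f_ f ff Uf).
Qed.

Lemma epi_cvg_continuous (Psi : Conv R n -> Conv R n) :
  (forall (f_ : nat -> Conv R n) f,
    epi_cvg f_ f -> epi_cvg (Psi \o f_) (Psi f)) ->
  continuous Psi.
Proof.
move=> h; apply/continuousP => A oA.
change (epi_open (Psi @^-1` A)) => f_ f ff Af.
exact: (oA _ _ (h _ _ ff) Af).
Qed.

Lemma cst0_proper_on p (S : set 'cV[R]_n) : S p ->
  exists2 x, S x & (cst_conv (n := n) 0 : Conv R n) x <> +oo%E.
Proof. by exists p. Qed.

Definition point_ind p : Conv R n :=
  MkConv (is_conv_restr (convex_closed1 p)
    (cst0_proper_on (erefl p : [set p] p))).

Lemma closed_nball0 j : closed_nball j (0 : 'cV[R]_n).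
Proof. by rewrite /closed_nball /= normr0. Qed.

Definition ball_ind j : Conv R n :=
  MkConv (is_conv_restr (convex_closed_nball j)
    (cst0_proper_on (closed_nball0 j))).

Lemma epi_cvg_ball : epi_cvg ball_ind (cst_conv 0).
Proof.
move=> x; split.
  move=> x_ _; apply: limn_einf_ge => a a0; apply: nearW => j.
  rewrite /= /restr; case: asboolP => _; last exact: leey.
  exact: ltW.
exists (fun=> x); split; first exact: cvg_cst.
apply: cvg_near_cst; near=> j; rewrite /= restr_in// /closed_nball /=.
by near: j; exact: nbhs_infty_ger.
Unshelve. all: by end_near. Qed.

Lemma epi_cvg_cone p : epi_cvg (cone_conv ^~ p) (point_ind p).
Proof.
move=> x; split.
  move=> x_ xx; apply: limn_einf_ge => a.
  have [->|/eqP xp] := eqVneq x p.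
    rewrite /= restr_in// => a0; apply: nearW => j.
    by rewrite (le_trans (ltW a0))// lee_fin mulr_ge0.
  move=> _; have d0 : 0 < `|x - p| by rewrite normr_gt0 subr_eq0; exact/eqP.
  have h1 : \forall j \near \oo, `|x - p| / 2 < `|x_ j - p|.
    have : `|x_ j - p| @[j --> \oo] --> `|x - p|.
      by apply: cvg_norm; apply: cvgB => //; exact: cvg_cst.
    by move=> h; apply: (h _ (lt_nbhsr _)); lra.
  near=> j; rewrite /= lee_fin.
  have j1 : `|x - p| / 2 < `|x_ j - p| by near: j.
  have j2 : `|a| / (`|x - p| / 2) <= j%:R by near: j; exact: nbhs_infty_ger.
  rewrite ler_pdivrMr in j2; last by lra.
  apply: (le_trans (ler_norm a)); apply: (le_trans j2).
  by apply: ler_wpM2l => //; exact: ltW.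
exists (fun=> x); split; first exact: cvg_cst.
have [->|/eqP xp] := eqVneq x p.
  rewrite /= restr_in//; apply: cvg_near_cst; apply: nearW => j.
  by rewrite subrr normr0 mulr0.
have d0 : 0 < `|x - p| by rewrite normr_gt0 subr_eq0; exact/eqP.
rewrite [point_ind p x]restr_out//; apply/cvgeyPge => A; near=> j.
rewrite /= lee_fin -ler_pdivrMr//; near: j; exact: nbhs_infty_ger.
Unshelve. all: by end_near. Qed.

Lemma lte_pmul_divl (l a : R) (z : \bar R) : 0 < l ->
  (a%:E < l%:E * z)%E = ((l^-1 * a)%:E < z)%E.
Proof.
move=> l0; case: z => [z| |].
- by rewrite -EFinM !lte_fin ltr_pdivrMl.
- by rewrite gt0_muley ?lte_fin// !ltry.
- by rewrite gt0_muleNy ?lte_fin.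
Qed.

(** Epi-convergence is stable under f |-> l f(m x): both conditions at x follow
    from those at m x, after rescaling the sequences of points. *)
Lemma epi_cvg_scale (l m : R) (f_ g_ : nat -> Conv R n) f g :
  0 < l -> m != 0 -> epi_cvg f_ f ->
  (forall j x, g_ j x = (l%:E * f_ j (m *: x)%R)%E) ->
  (forall x, g x = (l%:E * f (m *: x)%R)%E) ->
  epi_cvg g_ g.
Proof.
move=> l0 m0 ff gf_ gf x; have [lf [y_ [yx fy]]] := ff (m *: x); split.
  move=> x_ xx; apply: limn_einf_ge => a; rewrite gf lte_pmul_divl// => af.
  have mx : m *: x_ j @[j --> \oo] --> m *: x by apply: cvgZl_tmp.
  have := near_gt_limn_einf (lt_le_trans af (lf _ mx)).
  by apply: filterS => j; rewrite gf_ -lte_pmul_divl// => /ltW.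
exists (fun j => m^-1 *: y_ j); split.
  by rewrite -[x](scalerK m0); apply: cvgZl_tmp.
rewrite gf; under eq_fun do rewrite gf_ scalerA divff// scale1r.
by apply: cvgeZl.
Qed.

End epi_topology.

(** * Signed permutation matrices in SO(n) *)

Section signed_permutations.
Context {R : realType} {n : nat}.
Implicit Types (x y : 'cV[R]_n) (a b c i : 'I_n) (K : set 'cV[R]_n).

(** For a <> b this is a diagonal matrix of determinant 1; even permutation
    matrices and these flips are all the rotations that are needed. *)
Definition flip a b x : 'cV[R]_n :=
  \col_i (if (i == a) || (i == b) then - x i 0 else x i 0).

Lemma invmx_SO (eta : 'M[R]_n) : is_SO eta -> invmx eta = eta^T.
Proof.
move=> [oeta deta]; have ueta : eta \in unitmx by rewrite unitmxE deta unitr1.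
by rewrite -[RHS](mulmxK ueta) oeta mul1mx.
Qed.

Lemma SO_equivariantE (Psi : Conv R n -> Conv R n) (eta : 'M[R]_n)
    (f g : Conv R n) : SO_equivariant Psi -> is_SO eta ->
  (forall x, g x = f (eta^T *m x)) -> forall x, Psi g x = Psi f (eta^T *m x).
Proof.
move=> SOPsi etaP gf x.
have -> : g = rotate etaP f.
  by apply: conv_ext => z; rewrite gf /= invmx_SO.
by rewrite SOPsi /= invmx_SO.
Qed.

Lemma SO_equivariant_flip (Psi : Conv R n -> Conv R n) a b
    (f g : Conv R n) : SO_equivariant Psi -> a != b ->
  (forall x, g x = f (flip a b x)) -> forall x, Psi g x = Psi f (flip a b x).
Proof.
move=> SOPsi ab.
pose d : 'rV[R]_n := \row_i (if (i == a) || (i == b) then -1 else 1).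
have dE x : (diag_mx d)^T *m x = flip a b x.
  apply/matrixP => i j; rewrite tr_diag_mx mul_diag_mx !mxE (ord1 j).
  by case: ifP; rewrite ?mulN1r ?mul1r.
move=> gf x; rewrite -dE; apply: SO_equivariantE => // [|z]; last by rewrite dE.
split.
  rewrite tr_diag_mx mulmx_diag; apply/matrixP => i j; rewrite !mxE.
  by case: ifP; rewrite ?mulrNN mulr1.
rewrite det_diag (bigD1 a)//= (bigD1 b) 1?eq_sym//= big1 => [|i].
  by rewrite !mxE !eqxx orbT /=; ring.
by rewrite mxE => /andP[/negPf-> /negPf->].
Qed.

Lemma SO_equivariant_perm (Psi : Conv R n -> Conv R n) (s : 'S_n)
    (f g : Conv R n) : SO_equivariant Psi -> ~~ odd_perm s ->
  (forall x, g x = f (row_perm s x)) ->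
  forall x, Psi g x = Psi f (row_perm s x).
Proof.
move=> SOPsi es; have sE x : (perm_mx s^-1)^T *m x = row_perm s x.
  by rewrite tr_perm_mx invgK row_permE.
move=> gf x; rewrite -sE; apply: SO_equivariantE => // [|z]; last by rewrite sE.
split; first by rewrite tr_perm_mx invgK -perm_mxM mulgV perm_mx1.
by rewrite det_perm odd_permV (negPf es).
Qed.

Lemma third_index a b : (3 <= n)%N -> exists c, c != a /\ c != b.
Proof.
move=> n3; have : ~~ ([set: 'I_n]%SET \subset [set a; b]%SET).
  apply/negP => /subset_leq_card; rewrite cardsT card_ord cards2.
  by case: (a != b) => /=; lia.
by case/fintype.subsetPn => c _; rewrite in_set2 negb_or => /andP[]; exists c.
Qed.

(** A third index turns a transposition into a 3-cycle. *)
Lemma even_perm_transitive a b : (3 <= n)%N ->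
  exists s : 'S_n, ~~ odd_perm s /\ s b = a.
Proof.
move=> n3; have [->|ab] := eqVneq a b.
  by exists 1%g; rewrite odd_perm1 perm1.
have [c [ca cb]] := third_index a b n3.
exists (tperm b c * tperm c a)%g.
by rewrite odd_permM !odd_tperm eq_sym cb ca permM !tpermL.
Qed.

(** The average of y and [flip a b y] is y with the coordinates a and b erased.
    Repeating this erases every coordinate outside J, provided that these can
    be paired among themselves. *)
Lemma convex_flip_zero K (J : pred 'I_n) x :
  (forall y z, K y -> K z -> K (2^-1 *: (y + z))) ->
  (forall a b y, a != b -> ~~ J a -> ~~ J b -> K y -> K (flip a b y)) ->
  (forall a, ~~ J a -> exists2 b, a != b & ~~ J b) ->
  K x -> K (\col_i (if J i then x i 0 else 0)).
Proof.
move=> Kmid Kflip Jpair Kx.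
have step (r : seq 'I_n) : exists y, [/\ K y, forall i, J i -> y i 0 = x i 0 &
    forall i, i \in r -> ~~ J i -> y i 0 = 0].
  elim: r => [|a r [y [Ky Jy ry]]]; first by exists x.
  have [Ja|Ja] := boolP (J a).
    exists y; split => // i; rewrite inE => /orP[/eqP->|/ry//].
    by rewrite Ja.
  have [b ab Jb] := Jpair a Ja.
  exists (2^-1 *: (y + flip a b y)); split.
  - by apply: Kmid => //; exact: Kflip.
  - move=> i Ji; rewrite !mxE; case: ifPn => [/orP[]/eqP ei|_].
    + by rewrite -ei Ji in Ja.
    + by rewrite -ei Ji in Jb.
    + by rewrite Jy//; lra.
  - move=> i; rewrite inE !mxE => /orP[ia _|ir Ji].
      by rewrite ia /= subrr mulr0.
    by case: ifP => _; rewrite ry//; lra.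
have [y [Ky Jy ry]] := step (enum 'I_n).
have -> // : \col_i (if J i then x i 0 else 0) = y.
apply/matrixP => i j; rewrite mxE (ord1 j).
by case: ifPn => [/Jy|/ry->//]; rewrite ?mem_enum.
Qed.

(** A nonzero vector of K has a coordinate r <> 0, say the a-th.  Erasing the
    others puts r e_a in K; a flip gives - r e_a, so K contains the a-th axis,
    hence every axis, hence everything.  The 0 is obtained by erasing all
    coordinates. *)
Lemma invariant_cone K : (3 <= n)%N ->
  (forall y z, K y -> K z -> K (2^-1 *: (y + z))) ->
  (forall t y, 0 < t -> K y -> K (t *: y)) ->
  (forall a b y, a != b -> K y -> K (flip a b y)) ->
  (forall (s : 'S_n) y, ~~ odd_perm s -> K y -> K (row_perm s y)) ->
  (exists x, K x) ->
  (K 0 /\ forall x, x != 0 -> ~ K x) \/ (forall x, K x).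
Proof.
move=> n3 Kmid Kscale Kflip Kperm [x0 Kx0].
have K0 : K 0.
  have -> : (0 : 'cV[R]_n) = \col_i (if pred0 i then x0 i 0 else 0).
    by apply/matrixP => i j; rewrite !mxE.
  apply: (@convex_flip_zero K pred0 x0) => // [a b y ab _ _|a _].
    exact: Kflip.
  by have [b [ba _]] := third_index a a n3; exists b => //; rewrite eq_sym.
have [[x Kx xn0]|noK] := pselect (exists2 x, K x & x != 0); last first.
  by left; split=> // x xn0 Kx; apply: noK; exists x.
right => z.
have [a xa0] : exists a, x a 0 != 0.
  apply: contrapT => /forallNP h; move/eqP: xn0; apply.
  by apply/matrixP => i j; rewrite (ord1 j) mxE; apply/eqP/negPn/negP/h.
pose y := x a 0 *: (delta_mx a 0 : 'cV[R]_n).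
have yE i j : y i j = if i == a then x a 0 else 0.
  by rewrite !mxE (ord1 j) andbT; case: ifP => _; rewrite ?mulr1 ?mulr0.
have Ky : K y.
  have -> : y = \col_i (if pred1 a i then x i 0 else 0).
    by apply/matrixP => i j; rewrite yE mxE /=; case: eqP => // ->.
  apply: (@convex_flip_zero K (pred1 a) x) => // [b c v bc _ _|b ba].
    exact: Kflip.
  by have [c [cb ca]] := third_index b a n3; exists c => //; rewrite eq_sym.
have KNy : K (- y).
  have [c [ca _]] := third_index a a n3.
  have -> : - y = flip a c y.
    apply/matrixP => i j; rewrite !mxE -!/(y _ _) (ord1 j) andbT.
    case: eqP => //= ia; case: ifP => // _; ring.
  by apply: Kflip => //; rewrite eq_sym.
have Kline r : K (r *: delta_mx a 0).
  have -> : r *: delta_mx a 0 = (r / x a 0) *: y.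
    by rewrite scalerA divfK.
  have [t0|t0|->] := ltrgtP (r / x a 0) 0; last by rewrite scale0r.
  - rewrite -[X in K X]opprK -scalerN -scaleNr.
    by apply: Kscale => //; rewrite oppr_gt0.
  - exact: Kscale.
have Kaxis r b : K (r *: delta_mx b 0).
  have [s [es sb]] := even_perm_transitive a b n3.
  have -> : r *: delta_mx b 0 = row_perm s (r *: (delta_mx a 0 : 'cV[R]_n)).
    by apply/matrixP => i j; rewrite !mxE -sb (inj_eq perm_inj).
  exact: Kperm.
rewrite [z]matrix_sum_delta; apply: (big_ind K) => // [u v Ku Kv|i _].
  rewrite -[u + v](@scalerKV _ _ 2)// ?pnatr_eq0//.
  by apply: Kscale => //; exact: Kmid.
by rewrite big_ord1 (_ : ord0 = 0)//; exact: Kaxis.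
Qed.

End signed_permutations.

(** * Affine minorants on a segment *)

Section affine_minorant.
Context {R : realType} {n : nat}.
Implicit Types (f : Conv R n) (p q : 'cV[R]_n).

Lemma near_segment (q p : 'cV[R]_n) (s0 : R) (V : set 'cV[R]_n) :
  nbhs (q + s0 *: (p - q)) V ->
  exists2 e : R, 0 < e < 1 & forall s, `|s - s0| <= e -> V (q + s *: (p - q)).
Proof.
move=> /(@line_continuous R n q p s0) /nbhs_ballP[e /= e0 eV].
exists (Num.min e 1 / 2).
  rewrite divr_gt0 ?lt_min ?e0 ?ltr01//= ltr_pdivrMr// mul1r gt_min.
  by rewrite ltr1n orbT.
move=> s se; apply: eV; rewrite /ball /= distrC (le_lt_trans se)//.
rewrite ltr_pdivrMr// (le_lt_trans (_ : _ <= e))//.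
  by rewrite ge_min lexx.
by lra.
Qed.

(** Near q the bound comes from semi-continuity.  Far from q, convexity between
    q and the point of parameter s bounds f from below by the line through the
    values at parameters 0 and e, whose slope is at least -1/e. *)
Lemma segment_bounded_below f q p (r : R) : f q = r%:E ->
  exists m : R, forall s, 0 <= s <= 1 -> (m%:E <= f (q + s *: (p - q))%R)%E.
Proof.
move=> fq; have rq : ((r - 1)%:E < f q)%E by rewrite fq lte_fin; lra.
have [V qV Va] := conv_lsc (convP f) rq.
have := @near_segment q p 0 V; rewrite scale0r addr0 => /(_ qV).
move=> [e /andP[e0 e1] eV].
(* r - 1/e is below r - 1, as e < 1, and at most r - s/e for s <= 1. *)
exists (r - e^-1) => s /andP[s0 s1].
have ei1 : 1 < e^-1 by rewrite invf_gt1.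
have [se|es] := leP s e.
  apply: ltW; apply: le_lt_trans (Va _ (eV s _)); first by rewrite lee_fin; lra.
  by rewrite subr0 ger0_norm.
have s_gt0 : 0 < s by exact: lt_trans es.
have fe : ((r - 1)%:E < f (q + e *: (p - q))%R)%E.
  by apply/Va/eV; rewrite subr0 gtr0_norm.
have tP : 0 < e / s < 1 by rewrite divr_gt0//= ltr_pdivrMr// mul1r.
have := conv_convex (convP f) (q + s *: (p - q)) q tP.
have -> : (e / s) *: (q + s *: (p - q)) + (1 - e / s) *: q = q + e *: (p - q).
  by apply/matrixP => i j; rewrite !mxE; field; exact: lt0r_neq0.
rewrite fq; case fs : (f (q + s *: (p - q))) => [v| |]; last 2 first.
- by move=> _; exact: leey.
- by have := conv_gtNy (convP f) (q + s *: (p - q)); rewrite fs.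
move=> /(lt_le_trans fe); rewrite -!EFinM -EFinD lte_fin lee_fin.
have -> : e / s * v + (1 - e / s) * r = r + e / s * (v - r) by ring.
move=> h; have {}h : - 1 < e / s * (v - r) by lra.
have : - (s / e) < v - r.
  rewrite -[X in _ < X](mulKf (x := e / s)); last by rewrite gt_eqF//; lra.
  rewrite invf_div; have : s / e * -1 < s / e * (e / s * (v - r)).
    by rewrite ltr_pM2l// divr_gt0.
  by lra.
have : s / e <= e^-1 by rewrite -[leRHS]mul1r ler_pM2r// invr_gt0.
by lra.
Qed.

(** By semi-continuity f > N on a piece of the segment next to p, and f is
    bounded below by some m' <= N on the rest; the line with value N at p and
    m' at the start of that piece lies below f.  A coordinate in which p and q
    differ serves as the parameter of the segment. *)
Lemma affine_minorant_segment f q p (r N : R) : f q = r%:E -> f p = +oo%E ->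
  exists i c d, c * p i 0 + d = N /\
    forall z, segment q p z -> ((c * z i 0 + d)%:E <= f z)%E.
Proof.
move=> fq fp; have [m mf] := segment_bounded_below p fq.
have [i piq] : exists i, p i 0 - q i 0 != 0.
  apply: contrapT => /forallNP h; suff pq : p = q by rewrite pq fq in fp.
  apply/matrixP => i j; rewrite (ord1 j).
  by apply/eqP; rewrite -subr_eq0; apply/negPn/negP/h.
have Np : (N%:E < f p)%E by rewrite fp ltry.
have [V pV Va] := conv_lsc (convP f) Np.
have := @near_segment q p 1 V; rewrite scale1r addrC subrK => /(_ pV).
move=> [e /andP[e0 e1] eV].
pose m' := Num.min m N; pose C := (N - m') / e.
have m'N : m' <= N by rewrite ge_min lexx orbT.
have m'm : m' <= m by rewrite ge_min lexx.
have C0 : 0 <= C by rewrite divr_ge0 ?(ltW e0)// subr_ge0.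
exists i, (C / (p i 0 - q i 0)), (N - C - C / (p i 0 - q i 0) * q i 0).
split; first by field.
move=> _ [s + <-]; rewrite /= in_itv /= => /andP[s0 s1]; rewrite !mxE.
have -> : C / (p i 0 - q i 0) * (q i 0 + s * (p i 0 - q i 0)) +
   (N - C - C / (p i 0 - q i 0) * q i 0) = N + C * (s - 1) by field.
have [se|se] := leP (1 - e) s.
  apply/ltW/(le_lt_trans _ (Va _ (eV s _))).
    by rewrite lee_fin; nra.
  by rewrite ler_norml; lra.
apply: le_trans (mf s _); last by rewrite s0 s1.
rewrite lee_fin; apply: (le_trans _ m'm).
have -> : m' = N + C * - e by rewrite /C; field; exact: lt0r_neq0.
by rewrite lerD2l ler_wpM2l//; lra.
Qed.

End affine_minorant.

(** * Additive maps *)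

(** c |-> L c - c L(1) is additive, vanishes on the integers and is bounded on
    [0, 1], hence bounded, hence zero. *)
Lemma additive_nondecreasing_linear (R : realType) (L : R -> R) :
  (forall a b, L (a + b) = L a + L b) -> (forall a b, a <= b -> L a <= L b) ->
  forall c, L c = c * L 1.
Proof.
move=> LD Lmono.
have L0 : L 0 = 0 by have := LD 0 0; rewrite addr0; lra.
have LN a : L (- a) = - L a by have := LD a (- a); rewrite subrr L0; lra.
have Lnat k a : L (k%:R * a) = k%:R * L a.
  elim: k => [|k IH]; first by rewrite !mul0r L0.
  by rewrite -natr1 !mulrDl !mul1r LD IH.
have Lint (m : int) : L m%:~R = m%:~R * L 1.
  case: m => k; first by rewrite -pmulrn -Lnat mulr1.
  by rewrite NegzE mulrNz -pmulrn LN mulNr -Lnat mulr1.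
have Dbnd c : `|L c - c * L 1| <= L 1.
  have m1 := floor_le_tmp c; have m2 := floorD1_gt c.
  set m := Num.floor c in m1 m2; rewrite rmorphD /= in m2.
  have -> : L c - c * L 1 = L (c - m%:~R) - (c - m%:~R) * L 1.
    by rewrite LD LN Lint; ring.
  have h0 : 0 <= L (c - m%:~R) by rewrite -L0; apply: Lmono; lra.
  have h1 : L (c - m%:~R) <= L 1 by apply: Lmono; lra.
  have L1 : 0 <= L 1 by exact: le_trans h1.
  by rewrite ler_norml; nra.
move=> c; apply/eqP; rewrite -subr_eq0 -normr_le0 leNgt; apply/negP => d0.
set d := `|_| in d0; have [k kd] : exists k : nat, L 1 / d < k%:R.
  by exists (Num.truncn (L 1 / d)).+1; exact: truncnS_gt.
have := Dbnd (k%:R * c); rewrite Lnat -mulrA -mulrBr normrM normr_nat -/d.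
by rewrite leNgt -ltr_pdivrMr// kd.
Qed.

Section endomorphism.
Context {R : realType} {n : nat}.
Variable Psi : Conv R n -> Conv R n.
Hypothesis addPsi : additive_map Psi.
Implicit Types (f g h : Conv R n) (x y p q : 'cV[R]_n).

Lemma additive_map_eq f g h : (forall x, h x = f x + g x)%E ->
  forall x, (Psi h x = Psi f x + Psi g x)%E.
Proof.
move=> hfg x; have gh : is_conv (fun x => f x + g x)%E.
  have <- : conv_fun h = (fun x => f x + g x)%E by exact/funext.
  exact: convP.
by rewrite -(addPsi gh); congr (Psi _ x); exact: conv_ext.
Qed.

Lemma restr_addE f (S : set 'cV[R]_n) x :
  (restr f S x = f x + restr (cst_conv (n := n) 0) S x)%E.
Proof.
rewrite /restr; case: asboolP => _; first by rewrite adde0.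
by rewrite addey//; have := conv_gtNy (convP f) x; rewrite ltNye.
Qed.

Lemma additive_restr f S (cS : convex_closed S) ne ne0 x :
  (Psi (MkConv (is_conv_restr (f := f) cS ne)) x =
   Psi f x + Psi (MkConv (is_conv_restr (f := cst_conv 0) cS ne0)) x)%E.
Proof. by apply: additive_map_eq => z; exact: restr_addE. Qed.

(** e + e = e leaves only 0, +oo and -oo, and the last is excluded. *)
Lemma additive_idem f x : (forall z, f z + f z = f z)%E ->
  Psi f x = 0%E \/ Psi f x = +oo%E.
Proof.
move=> ff; have := additive_map_eq (fun z => esym (ff z)) x.
have := conv_gtNy (convP (Psi f)) x.
case: (Psi f x) => [r| |] // _; last by right.
by rewrite -EFinD => -[] rr; left; congr EFin; lra.
Qed.

Lemma additive_indicator S (cS : convex_closed S) ne x :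
  let g := MkConv (is_conv_restr (f := cst_conv 0) cS ne) in
  Psi g x = 0%E \/ Psi g x = +oo%E.
Proof.
move=> g; apply: additive_idem => z /=.
by rewrite /restr; case: asboolP; rewrite ?adde0.
Qed.

Lemma additive_point_ind p x :
  Psi (point_ind p) x = 0%E \/ Psi (point_ind p) x = +oo%E.
Proof. exact: additive_indicator. Qed.

(** This is f + 1_p = f(p) + 1_p read through Psi. *)
Lemma additive_eq_cst f p (r : R) x : f p = r%:E -> Psi (point_ind p) x = 0%E ->
  Psi f x = Psi (cst_conv r) x.
Proof.
move=> fp px.
have ne : exists2 z, [set p] z & f z <> +oo%E by exists p; rewrite ?fp.
have : (Psi (MkConv (is_conv_restr (f := f) (convex_closed1 p) ne)) x =
        Psi f x + Psi (point_ind p) x)%E by exact: additive_restr.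
rewrite px adde0 => <-.
rewrite -[RHS]adde0 -px; apply: additive_map_eq => z; rewrite -restr_addE /=.
by rewrite /restr; case: asboolP => // ->.
Qed.

Lemma additive_point_ind_zero p : exists x, Psi (point_ind p) x = 0%E.
Proof.
have [x [r Er]] := proper_pt (Psi (point_ind p)); exists x.
by have [//|] := additive_point_ind p x; rewrite Er.
Qed.

(** ** The zero set of the image of 0 *)

Section ind0_case.
Hypotheses (Psi00 : Psi (cst_conv 0) 0 = 0%E)
  (Psi0y : forall x, x != 0 -> Psi (cst_conv 0) x = +oo%E).

Lemma endomorphism_ind0 : (0 < n)%N -> forall f x, Psi f x = ind0 x.
Proof.
move=> n0 f.
have Psify g x : x != 0 -> Psi g x = +oo%E.
  move=> xn0; have -> : (Psi g x = Psi g x + Psi (cst_conv 0) x)%E.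
    by apply: additive_map_eq => z; rewrite adde0.
  rewrite Psi0y// addey//.
  by have := conv_gtNy (convP (Psi g)) x; rewrite ltNye.
have Psip p : Psi (point_ind p) 0 = 0%E.
  have [x px] := additive_point_ind_zero p; have [<-//|xn0] := eqVneq x 0.
  by rewrite Psify in px.
have Psic c : Psi (cst_conv c) 0 = 0%E.
  pose i : 'I_n := Ordinal n0.
  rewrite -(@additive_eq_cst (affine_conv i 1 0) (const_mx c) c 0)//;
    last first.
    by rewrite /= mxE mul1r addr0.
  by rewrite (@additive_eq_cst _ 0 0 0)// /= mxE mulr0 addr0.
move=> x; rewrite /ind0; case: eqVneq => [->|]; last exact: Psify.
by have [p [r fp]] := proper_pt f; rewrite (@additive_eq_cst f p r 0)// Psic.
Qed.
End ind0_case.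

Lemma additive_zero_cases : (3 <= n)%N ->
  radially_equivariant Psi -> SO_equivariant Psi ->
  (Psi (cst_conv 0) 0 = 0%E /\
   forall x, x != 0 -> Psi (cst_conv 0) x = +oo%E) \/
  (forall x, Psi (cst_conv 0) x = 0%E).
Proof.
move=> n3 radPsi SOPsi.
have c0 x : Psi (cst_conv 0) x = 0%E \/ Psi (cst_conv 0) x = +oo%E.
  by apply: additive_idem => z /=; rewrite adde0.
pose K : set 'cV[R]_n := [set x | Psi (cst_conv 0) x = 0%E].
suff [[K0 Kn]|] : (K 0 /\ forall x, x != 0 -> ~ K x) \/ forall x, K x.
- by left; split=> // x /Kn; have [|] := c0 x.
- by right.
apply: invariant_cone => //.
- move=> y z; rewrite /K /= => Ky Kz; have [//|] := c0 (2^-1 *: (y + z)).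
  have h2 : 0 < (2^-1 : R) < 1 by lra.
  have := conv_convex (convP (Psi (cst_conv 0))) y z h2.
  rewrite (_ : 1 - 2^-1 = 2^-1 :> R); last by lra.
  by rewrite Ky Kz !mule0 adde0 scalerDr => /[swap] ->.
- move=> t y t0; rewrite /K /= => Ky; rewrite (radPsi t t0) -[RHS]Ky.
  congr (Psi _ y).
  exact: conv_ext.
- move=> a b y ab; rewrite /K /= => Ky.
  by rewrite -(@SO_equivariant_flip _ _ Psi a b (cst_conv 0) (cst_conv 0)).
- move=> s y es; rewrite /K /= => Ky.
  by rewrite -(@SO_equivariant_perm _ _ Psi s (cst_conv 0) (cst_conv 0)).
- have [x [r Er]] := proper_pt (Psi (cst_conv 0)); exists x => /=.
  by have [//|] := c0 x; rewrite Er.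
Qed.

(** ** Images of affine functions when 0 is sent to 0 *)

Section nontrivial_case.
Hypothesis Psi0 : forall x, Psi (cst_conv 0) x = 0%E.

Section real_valued.
Variables f g : Conv R n.
Hypothesis fg : forall x, (f x + g x = 0)%E.

Lemma additive_opp x : (Psi f x + Psi g x = 0)%E.
Proof. by rewrite -(Psi0 x); apply/esym/additive_map_eq => z; rewrite fg. Qed.

Lemma additive_fin_num x : Psi f x \is a fin_num.
Proof.
have := additive_opp x; have := conv_gtNy (convP (Psi f)) x.
have := conv_gtNy (convP (Psi g)) x.
by case: (Psi f x) => [r| |] //; case: (Psi g x).
Qed.

End real_valued.

Lemma fine_additive_opp f g x : (forall z, f z + g z = 0)%E ->
  fine (Psi g x) = - fine (Psi f x).
Proof.
move=> fg; have gf z : (g z + f z = 0)%E by rewrite addeC.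
have := additive_opp fg x.
rewrite -(fineK (additive_fin_num fg x)) -(fineK (additive_fin_num gf x)).
by rewrite -EFinD => -[] /=; lra.
Qed.

(** Both Psi f and Psi g = - Psi f are convex. *)
Lemma additive_affine f g : (forall x, f x + g x = 0)%E ->
  forall x y t, 0 < t < 1 ->
  fine (Psi f (t *: x + (1 - t) *: y)) =
  t * fine (Psi f x) + (1 - t) * fine (Psi f y).
Proof.
move=> fg x y t t01; have gf z : (g z + f z = 0)%E by rewrite addeC.
pose F z := fine (Psi f z).
have fF z : Psi f z = (F z)%:E by rewrite /F (fineK (additive_fin_num fg z)).
have gF z : Psi g z = (- F z)%:E.
  by rewrite -(fine_additive_opp _ fg) (fineK (additive_fin_num gf z)).
have := conv_convex (convP (Psi f)) x y t01.
have := conv_convex (convP (Psi g)) x y t01.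
rewrite !fF !gF -!EFinM -!EFinD !lee_fin /= => h1 h2.
by apply/eqP; rewrite eq_le h2 /=; lra.
Qed.

(** The image of a constant is affine and invariant under dilations, hence
    constant; its value depends additively and monotonically on c. *)
Lemma image_cst : radially_equivariant Psi -> monotone_map Psi ->
  exists2 l : R, 0 <= l & forall c x, Psi (cst_conv c) x = (l * c)%:E.
Proof.
move=> radPsi monPsi.
have cN (c : R) (z : 'cV[R]_n) :
    (cst_conv (n := n) c z + cst_conv (n := n) (- c) z = 0)%E.
  by rewrite /= -EFinD subrr.
pose L c := fine (Psi (cst_conv c) 0).
have PsiL c x : Psi (cst_conv c) x = (L c)%:E.
  have h2 : 0 < (2^-1 : R) < 1 by lra.
  have := additive_affine (cN c) (2 *: x) 0 h2.
  have -> : Psi (cst_conv c) (2 *: x) = Psi (cst_conv c) x.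
    have p2 : 0 < 2 :> R by lra.
    by rewrite (radPsi 2 p2); congr (Psi _ x); exact: conv_ext.
  rewrite scaler0 addr0 scalerA mulVf ?pnatr_eq0// scale1r => h.
  by rewrite -(fineK (additive_fin_num (cN c) x)); congr EFin; rewrite /L; lra.
have LE : forall c, L c = c * L 1.
  apply: additive_nondecreasing_linear => [a b|a b ab].
    apply: EFin_inj; rewrite EFinD -!(PsiL _ 0).
    by apply: additive_map_eq => z; rewrite /= EFinD.
  by rewrite -lee_fin -!(PsiL _ 0); apply: monPsi => z; rewrite lee_fin.
exists (L 1) => [|c x]; last by rewrite PsiL LE mulrC.
have : (Psi (cst_conv 0) 0%R <= Psi (cst_conv 1) 0%R)%E.
  by apply: monPsi => z; rewrite lee_fin.
by rewrite Psi0 PsiL lee_fin.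
Qed.

(** The image h_i of the i-th coordinate is affine and h_i(2x) = 2 h_i(x), so it
    is positively homogeneous.  Flips away from i fix h_i, so averaging reduces
    h_i(x) to h_i(x_i e_i); flips at i change its sign, which settles negative
    x_i.  A 3-cycle compares two coordinates. *)
Lemma image_coordinate : (3 <= n)%N ->
  radially_equivariant Psi -> SO_equivariant Psi ->
  exists mu : R, forall i x, Psi (affine_conv i 1 0) x = (mu * x i 0)%:E.
Proof.
move=> n3 radPsi SOPsi.
have cN i (z : 'cV[R]_n) : (affine_conv i 1 0 z + affine_conv i (-1) 0 z = 0)%E.
  by rewrite /= -EFinD; congr EFin; ring.
pose h i x := fine (Psi (affine_conv i 1 0) x).
have hE i x : Psi (affine_conv i 1 0) x = (h i x)%:E.
  by rewrite /h (fineK (additive_fin_num (cN i) x)).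
have haff i : forall x y t, 0 < t < 1 ->
    h i (t *: x + (1 - t) *: y) = t * h i x + (1 - t) * h i y.
  exact: additive_affine (cN i).
have h0 i : h i 0 = 0.
  have : (Psi (affine_conv i 1 0) (2 *: 0%R) =
      Psi (affine_conv i 1 0) 0%R + Psi (affine_conv i 1 0) 0%R)%E.
    have p2 : 0 < 2 :> R by lra.
    rewrite (radPsi 2 p2); apply: additive_map_eq => z.
    by rewrite /= mxE -EFinD; congr EFin; ring.
  by rewrite scaler0 !hE -EFinD => -[]; lra.
have hshrink i t x : 0 < t < 1 -> h i (t *: x) = t * h i x.
  by move=> t01; have := haff i x 0 t t01; rewrite scaler0 addr0 h0 mulr0 addr0.
have hpos i t x : 0 < t -> h i (t *: x) = t * h i x.
  move=> t0; have [t1|t1|->] := ltrgtP t 1; last by rewrite scale1r mul1r.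
    by apply: hshrink; rewrite t0.
  have ti : 0 < t^-1 < 1 by rewrite invr_gt0 t0 invf_lt1.
  have := hshrink i t^-1 (t *: x) ti.
  rewrite scalerA mulVf ?gt_eqF// scale1r => ->.
  by rewrite mulrA divff ?gt_eqF// mul1r.
have hflip i a b x : a != b -> i != a -> i != b -> h i (flip a b x) = h i x.
  move=> ab ia ib; rewrite /h; congr fine; apply/esym.
  apply: (SO_equivariant_flip SOPsi ab) => z.
  by rewrite /= mxE (negPf ia) (negPf ib).
have hflipN i b x : i != b -> h i (flip i b x) = - h i x.
  move=> ib; rewrite -(fine_additive_opp x (cN i)) /h; congr fine; apply/esym.
  apply: (SO_equivariant_flip SOPsi ib) => z.
  by rewrite /= mxE eqxx /=; congr EFin; ring.
pose e i : 'cV[R]_n := delta_mx i 0.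
have hlin i x : h i x = h i (e i) * x i 0.
  have -> : h i x = h i (x i 0 *: e i).
    have -> : x i 0 *: e i = \col_j (if pred1 i j then x j 0 else 0).
      apply/matrixP => j k; rewrite !mxE (ord1 k) andbT /=.
      by case: eqP => [->|]; rewrite ?mulr1 ?mulr0.
    apply/esym.
    apply: (@convex_flip_zero R n [set y | h i y = h i x] (pred1 i) x) => //.
    - move=> y z /= yx zx; have h2 : 0 < (2^-1 : R) < 1 by lra.
      have := haff i y z _ h2; rewrite (_ : 1 - 2^-1 = 2^-1 :> R); last by lra.
      by rewrite scalerDr => ->; rewrite yx zx; lra.
    - by move=> a b y ab /= ai bi; rewrite hflip// eq_sym.
    - move=> a _; have [b [ba bi]] := third_index a i n3.
      by exists b => //; rewrite eq_sym.
  have [t0|t0|->] := ltrgtP (x i 0) 0; last by rewrite scale0r h0 mulr0.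
    have [b [bi _]] := third_index i i n3.
    have -> : x i 0 *: e i = - x i 0 *: flip i b (e i).
      apply/matrixP => j k; rewrite !mxE (ord1 k) andbT.
      by case: eqP => //= [_|]; [ring|case: ifP => _ _; ring].
    by rewrite hpos ?oppr_gt0// hflipN 1?eq_sym//; ring.
  by rewrite hpos// mulrC.
pose i0 : 'I_n := Ordinal (ltnW (ltnW n3)).
exists (h i0 (e i0)) => i x; rewrite hE; congr EFin.
have [s [es si]] := even_perm_transitive i i0 n3.
have hp : Psi (affine_conv i 1 0) x = Psi (affine_conv i0 1 0) (row_perm s x).
  by apply: SO_equivariant_perm => // z; rewrite /= mxE si.
by rewrite /h hp -/(h i0 _) hlin mxE si.
Qed.

(** ** The endomorphisms *)

(** Continuity is applied twice: along 1_(B_j) -> 0, where B_j is the ball of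
    radius j, and along the cones k|z - p| -> 1_p. *)
Lemma endomorphism_zero : continuous Psi -> monotone_map Psi ->
  (forall c x, Psi (cst_conv c) x = 0%E) -> forall f x, Psi f x = 0%E.
Proof.
move=> cPsi monPsi PsiC.
have ball0 j z : (0 <= Psi (ball_ind j) z)%E.
  rewrite -(Psi0 z); apply: monPsi => y /=.
  by rewrite /restr; case: asboolP => // _; exact: leey.
have cone0 k p z : (Psi (cone_conv k p) z <= 0)%E.
  (* On B_j the cone is at most the constant M, whose image is 0. *)
  have bnd j y : (Psi (cone_conv k p) y <= Psi (ball_ind j) y)%E.
    pose M : R := k%:R * (j%:R + `|p|).
    have ne (c : Conv R n) (r : 'cV[R]_n -> R) : (forall y, c y = (r y)%:E) ->
        exists2 y, closed_nball j y & c y <> +oo%E.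
      by move=> cr; exists 0; [exact: closed_nball0|rewrite cr].
    have neK := ne (cone_conv k p) _ (fun=> erefl).
    have neM := ne (cst_conv M) _ (fun=> erefl).
    have ballE f ne' :
        (Psi (MkConv (is_conv_restr (f := f) (convex_closed_nball j) ne')) y =
         Psi f y + Psi (ball_ind j) y)%E by exact: additive_restr.
    apply: (@le_trans _ _ (Psi (cone_conv k p) y + Psi (ball_ind j) y)%E).
      by rewrite leeDl.
    rewrite -(ballE _ neK) -[leRHS]add0e -(PsiC M y) -(ballE _ neM).
    apply: monPsi => w /=.
    rewrite /restr; case: asboolP => // wj; rewrite lee_fin ler_wpM2l//.
    by rewrite (le_trans (ler_normB _ _))// lerD2r.
  rewrite leNgt; apply/negP => Kz.
  have lscK := conv_lsc (convP (Psi (cone_conv k p))).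
  have := continuous_epi_cvg cPsi epi_cvg_ball (open_not_ge lscK).
  move=> /(_ (ex_intro _ z _)); rewrite PsiC => /(_ Kz).
  move=> [N _ /(_ N (leqnn N))] /= [y].
  by apply/negP; rewrite -leNgt.
have point0 p z : Psi (point_ind p) z = 0%E.
  have [//|py] := additive_point_ind p z.
  have := continuous_epi_cvg cPsi (epi_cvg_cone p) (@open_conv_gt R n z 0%E).
  rewrite /= py => /(_ (ltry _)) [N _ /(_ N (leqnn N))] /=.
  by rewrite ltNge cone0.
move=> f x; have [p [r fp]] := proper_pt f.
by rewrite (@additive_eq_cst f p r x)// PsiC.
Qed.

(** Psi 1_p vanishes exactly at (l/m) p, which evaluates Psi f wherever f is
    finite; affine minorants on a segment give the value +oo elsewhere. *)
Lemma endomorphism_dilation l : (3 <= n)%N -> monotone_map Psi ->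
  radially_equivariant Psi -> SO_equivariant Psi ->
  0 < l -> (forall c x, Psi (cst_conv c) x = (l * c)%:E) ->
  exists2 mu : R, mu != 0 & forall f x, Psi f x = (l%:E * f (mu *: x)%R)%E.
Proof.
move=> n3 monPsi radPsi SOPsi l0 PsiC.
have [m Psim] := image_coordinate n3 radPsi SOPsi.
have mE p x : Psi (point_ind p) x = 0%E -> m *: x = l *: p.
  move=> px; apply/matrixP => i j; rewrite !mxE (ord1 j).
  have := additive_eq_cst (f := affine_conv i 1 0) (r := p i 0) _ px.
  by rewrite Psim PsiC /= mul1r addr0 => /(_ erefl) -[].
have m0 : m != 0.
  have [x /mE] := additive_point_ind_zero (const_mx 1).
  move=> /matrixP/(_ (Ordinal (ltnW (ltnW n3))) 0); rewrite !mxE mulr1.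
  by apply: contraPneq => ->; rewrite mul0r => /esym/eqP; rewrite gt_eqF.
exists (m / l) => [|f x].
  by rewrite mulf_neq0 ?invr_eq0// gt_eqF.
have point0 y : Psi (point_ind ((m / l) *: y)) y = 0%E.
  have [z pz] := additive_point_ind_zero ((m / l) *: y).
  suff zy : z = y by rewrite zy in pz.
  have := mE _ _ pz; rewrite scalerA mulrC divfK ?gt_eqF//.
  move=> /(congr1 (fun v => m^-1 *: v)).
  by rewrite !scalerA mulVf// !scale1r.
set p := (m / l) *: x.
have dom g (r : R) : g p = r%:E -> Psi g x = (l * r)%:E.
  by move=> gp; rewrite (additive_eq_cst gp) ?PsiC//; exact: point0.
case fp : (f p) => [r| |]; first by rewrite (dom _ _ fp).
- rewrite gt0_muley ?lte_fin//; apply/eqyP => A A0.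
  (* An affine function below f on [q, p] has value A / l at p, so its image
     has value A at x. *)
  have [q [r fq]] := proper_pt f.
  have [i [c [d [cp cf]]]] := affine_minorant_segment (A / l) fq fp.
  have neq (g : Conv R n) : (exists s, g q = s%:E) ->
      exists2 z, segment q p z & g z <> +oo%E.
    move=> [s gq]; exists q; last by rewrite gq.
    by exists 0; [rewrite /= in_itv /= lexx ler01|rewrite scale0r addr0].
  have cS := convex_closed_segment q p.
  have Sp : segment q p p.
    by exists 1; [rewrite /= in_itv /= ler01 lexx|rewrite scale1r addrC subrK].
  have ne0 := neq (cst_conv 0) (ex_intro _ 0 erefl).
  have nea := neq (affine_conv i c d) (ex_intro _ _ erefl).
  have nef := neq f (ex_intro _ _ fq).
  have := additive_restr cS nef ne0 x.
  rewrite (dom (MkConv (is_conv_restr cS ne0)) 0); last by rewrite /= restr_in.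
  rewrite mulr0 adde0 => <-.
  have <- :
      Psi (MkConv (is_conv_restr (f := affine_conv i c d) cS nea)) x = A%:E.
    rewrite (dom _ (A / l)); first by rewrite mulrC divfK ?gt_eqF.
    by rewrite /= restr_in//= cp.
  apply: monPsi => z /=; rewrite /restr; case: asboolP => // Sz.
  exact: cf.
- by have := conv_gtNy (convP f) p; rewrite fp.
Qed.

End nontrivial_case.
End endomorphism.

(** * The listed maps are endomorphisms *)

Section converse.
Context {R : realType} {n : nat}.
Implicit Type Psi : Conv R n -> Conv R n.

Let endo Psi := [/\ continuous Psi, additive_map Psi, monotone_map Psi,
  radially_equivariant Psi & SO_equivariant Psi].

Lemma constant_endomorphism Psi (z : 'cV[R]_n -> \bar R) :
  (forall x, z x + z x = z x)%E ->
  (forall (t : R) x, 0 < t -> z (t *: x) = z x) ->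
  (forall (eta : 'M[R]_n) x, is_SO eta -> z (invmx eta *m x) = z x) ->
  (forall f x, Psi f x = z x) -> endo Psi.
Proof.
move=> zz zt zeta Pz; split.
- suff -> : Psi = fun=> Psi (cst_conv 0) by exact: cst_continuous.
  by apply/funext => f; apply: conv_ext => x; rewrite !Pz.
- by move=> g h gh x; rewrite !Pz zz.
- by move=> f g _ x; rewrite !Pz.
- by move=> t t0 f x; rewrite !Pz zt.
- by move=> eta etaP f; apply: conv_ext => x; rewrite /= !Pz zeta.
Qed.

Lemma dilation_endomorphism Psi (l m : R) : 0 < l -> m != 0 ->
  (forall f x, Psi f x = (l%:E * f (m *: x)%R)%E) -> endo Psi.
Proof.
move=> l0 m0 PE; split.
- apply: epi_cvg_continuous => f_ f ff.
  by apply: (epi_cvg_scale l0 m0 ff) => [j x|x]; exact: PE.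
- move=> g h gh x; rewrite !PE /= muleDr//.
  by apply: ltninfty_adde_def; rewrite inE; exact: (conv_gtNy (convP _)).
- by move=> f g fg x; rewrite !PE lee_wpmul2l// lee_fin ltW.
- by move=> t t0 f x; rewrite !PE /= !scalerA mulrC.
- by move=> eta etaP f; apply: conv_ext => x; rewrite /= !PE /= scalemxAr.
Qed.

End converse.

Theorem corollary4 (R : realType) (n : nat) (n_ge3 : (3 <= n)%N)
    (Psi : Conv R n -> Conv R n) :
  [/\ continuous Psi, additive_map Psi, monotone_map Psi,
      radially_equivariant Psi & SO_equivariant Psi]
  <->
  [\/ forall (f : Conv R n) (x : 'cV[R]_n), Psi f x = 0%E,
      forall (f : Conv R n) (x : 'cV[R]_n), Psi f x = ind0 x
    | exists lambda mu : R, [/\ 0 < lambda, mu != 0 &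
        forall (f : Conv R n) (x : 'cV[R]_n),
          Psi f x = (lambda%:E * f (mu *: x)%R)%E]].
Proof.
split; last first.
  case=> [P0|P0|[l [m [l0 m0 PE]]]]; last exact: dilation_endomorphism PE.
  - apply: (@constant_endomorphism R n Psi (fun=> 0%E)) => // x.
    by rewrite adde0.
  - apply: (@constant_endomorphism R n Psi (@ind0 R n)) => //.
    + by move=> x; rewrite /ind0; case: ifP => _; rewrite ?adde0.
    + by move=> t x t0; rewrite /ind0 scaler_eq0 gt_eqF.
    + move=> eta x [_ deta]; rewrite /ind0.
      have ueta : eta \in unitmx by rewrite unitmxE deta unitr1.
      have -> // : (invmx eta *m x == 0) = (x == 0).
      apply/eqP/eqP => [h|->]; last exact: mulmx0.
      by rewrite -(mulKVmx ueta x) h mulmx0.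
move=> [cPsi addPsi monPsi radPsi SOPsi].
have [[P00 P0y]|P0] := additive_zero_cases addPsi n_ge3 radPsi SOPsi.
  apply: Or32; apply: (endomorphism_ind0 addPsi P00 P0y).
  exact: ltnW (ltnW n_ge3).
have [l l0 PsiC] := image_cst addPsi P0 radPsi monPsi.
have [l_eq0|l_neq0] := eqVneq l 0.
  apply: Or31; apply: endomorphism_zero => // c x.
  by rewrite PsiC l_eq0 mul0r.
have {}l0 : 0 < l by rewrite lt_neqAle eq_sym l_neq0.
have [m m0 PE] :=
  endomorphism_dilation addPsi P0 n_ge3 monPsi radPsi SOPsi l0 PsiC.
by apply: Or33; exists l, m.
Qed.
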